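(* For each positive integer $n$ and each positive integer $m<\frac{n}{2}$ there is an analogous Craig lattice of rank $n$ whose center density $\delta_n$ satisfies $\delta_n\geq \frac{m^{n/2}}{2^{m-1+\frac{n}{2}}\cdot n^{m-1}(n+1)^{1/2}}$. Moreover, for a suitable choice of $m$ (depending on $n$), the density $\Delta_n$ of this lattice satisfies $\frac{1}{n}\log_2\Delta_n\geq -\frac{1}{2}\log_2\log_2 n+o(1)$ as $n\to\infty$.
   Context: Let $R={\bf Z}\langle 1,x,\dots,x^n\rangle$ be the free ${\bf Z}$-module of integer polynomials of degree at most $n$, identified with ${\bf Z}^{n+1}\subset{\bf R}^{n+1}$ via coefficient vectors. For positive integers $m,l$, the analogous Craig lattice is ${\bf A}_n^{(m,l)}={\bf Z}(x-1)^n+\cdots+{\bf Z}(x-1)^m+l{\bf Z}(x-1)^{m-1}+\cdots+l{\bf Z}(x-1)$, a lattice of rank $n$ in ${\bf R}^{n+1}$. For a lattice ${\bf L}$ with shortest nonzero vector length $\lambda$ and volume $\mathrm{Vol}({\bf L})$ (square root of the Gram determinant), the center density is $\delta=(\lambda/2)^n/\mathrm{Vol}({\bf L})$ where $n$ is the rank, and the density is $\Delta=\delta V_n$ with $V_n$ the volume of the unit ball in ${\bf R}^n$. *)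

(* Defs.v *)
From mathcomp Require Import all_boot all_order all_algebra.
From mathcomp Require Import all_classical all_reals all_analysis.

Set Implicit Arguments.
Unset Strict Implicit.
Unset Printing Implicit Defensive.

Import Order.TTheory GRing.Theory Num.Theory.
Import numFieldNormedType.Exports.

Local Open Scope classical_set_scope.
Local Open Scope ring_scope.

Definition log2 (R : realType) (x : R) : R := ln x / ln 2.

(* The library norm [`|v|] on matrices is the sup norm, hence this separate
   Euclidean norm. *)
Definition enorm (R : realType) (N : nat) (v : 'rV[R]_N) : R :=
  Num.sqrt (\sum_(j < N) v 0 j ^+ 2).

(* The n-fold product of the Lebesgue measure on R: the successor case is the
   product measure [lebesgue_measure \x lebesgue_volume] unfolded, R^(1+n) being
   identified with R * R^n. It is used on Borel sets only. *)
Fixpoint lebesgue_volume (R : realType) (n : nat) : set 'rV[R]_n -> \bar R :=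
  if n is n'.+1 then fun A =>
    (\int[@lebesgue_measure R]_x
       lebesgue_volume [set v : 'rV[R]_n' | A (row_mx (x : R)%:M v)])%E
  else fun A => (\1_A (0 : 'rV[R]_0))%:E.

Definition unit_ball_volume (R : realType) (n : nat) : R :=
  fine (lebesgue_volume [set v : 'rV[R]_n | enorm v <= 1]).

(* A lattice of rank r in R^N is given by a basis, the rows of B; these are
   linearly independent exactly when [row_free B]. The quantities below depend
   only on [lattice_of B] when [row_free B]. *)
Definition lattice_of (R : realType) (r N : nat) (B : 'M[R]_(r, N)) :
    set 'rV[R]_N :=
  [set map_mx intr z *m B | z in [set: 'rV[int]_r]].

Definition min_length (R : realType) (N : nat) (L : set 'rV[R]_N) : R :=
  inf [set enorm v | v in L `\ 0].

Definition lattice_volume (R : realType) (r N : nat) (B : 'M[R]_(r, N)) : R :=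
  Num.sqrt (\det (B *m B^T)).

Definition center_density (R : realType) (r N : nat) (B : 'M[R]_(r, N)) : R :=
  (min_length (lattice_of B) / 2) ^+ r / lattice_volume B.

Definition density (R : realType) (r N : nat) (B : 'M[R]_(r, N)) : R :=
  center_density B * unit_ball_volume R r.

Definition craig_generator (m l k : nat) : {poly int} :=
  ('X - 1) ^+ k *+ (if (k < m)%N then l else 1%N).

(* Row i holds the coefficients of the generator of index i + 1, so that
   [lattice_of (craig_basis R n m l)] is A_n^(m,l). *)
Definition craig_basis (R : realType) (n m l : nat) : 'M[R]_(n, n.+1) :=
  \matrix_(i < n, j < n.+1) ((craig_generator m l i.+1)`_j)%:~R.

(* Main.v *)
Require Import Defs.
From mathcomp Require Import all_boot all_order all_algebra.
From mathcomp Require Import all_classical all_reals all_analysis.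
From mathcomp Require Import zify ring lra.

Set Implicit Arguments.
Unset Strict Implicit.
Unset Printing Implicit Defensive.

Import Order.TTheory GRing.Theory Num.Theory.
Import numFieldNormedType.Exports.

Local Open Scope classical_set_scope.
Local Open Scope ring_scope.

(* Take for [l] a prime [p] with [n < p <= 2n].

   Minimum.  Let [f] be a nonzero lattice vector, and split its coefficients
   into positive and negative parts; since [f(1) = 0] both parts have the same
   mass [s], and [|f|^2 >= 2s].  Modulo [p], [f] is divisible by [(x - 1)^m],
   so the multisets [X], [Y] of elements of [F_p] carried by the two parts have
   the same first [m] power sums.  If [s < m] then the polynomials with roots
   [X] and [Y] coincide, so [X = Y], a contradiction; hence [|f|^2 >= 2m].

   Volume.  Replace the constant row of the unitriangular matrix of the powers
   of [x - 1] by the all-one vector: the determinant becomes [n + 1], and the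
   new row is orthogonal to the others and has squared length [n + 1].  Hence
   the Gram determinant of the powers [(x - 1)^k], [1 <= k <= n], is [n + 1].

   Asymptotics.  For [m] close to [n / (2 log2 n)] the required bound holds with
   a constant to spare, so that the unit ball volume is only needed up to a factor
   [c^n]: integrating [(1 - x^2)^(n/2) >= 1 - (n + 2) x^2 / 2] over the slices
   gives [V_n >= (32/9)^(n/2) / sqrt (n+1)!], which suffices. *)

(** * Bertrand's postulate *)

Section Bertrand.
Local Open Scope nat_scope.

Lemma prod_primes_dvd (s : seq nat) (M : nat) :
  uniq s -> all prime s -> all (fun p => p %| M) s -> \prod_(p <- s) p %| M.
Proof.
elim: s => [|p s IHs] /=; first by rewrite big_nil dvd1n.
move=> /andP[p_notin_s s_uniq] /andP[p_pr s_pr] /andP[pM sM].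
rewrite big_cons Gauss_dvd ?pM ?IHs //.
rewrite prime_coprime // big_seq.
apply: (big_ind (fun q => ~~ (p %| q))) => [|x y px py|q qs].
- by rewrite dvdn1; case: p p_pr {p_notin_s pM} => [|[]].
- by rewrite Euclid_dvdM // negb_or px.
- rewrite dvdn_prime2 ?(allP s_pr q qs) //.
  by apply: contraNneq p_notin_s => ->.
Qed.

Lemma prime_dvd_fact (p n : nat) : prime p -> (p %| n`!) = (p <= n).
Proof.
move=> p_pr; elim: n => [|n IHn].
  by rewrite fact0 dvdn1; case: p p_pr => [|[]].
rewrite factS Euclid_dvdM // {}IHn.
have [pn|np] := leqP p n; first by rewrite orbT leqW.
rewrite orbF leq_eqVlt ltnS leqNgt np orbF.
have [->|neq] := eqVneq p n.+1; first by rewrite dvdnn.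
by apply/negbTE; rewrite gtnNdvd // ltn_neqAle eq_sym neq.
Qed.

(** From [k] to [k + 1] the coefficient is multiplied by [2 (2k + 3) / (k + 2)], which is less than
    4. *)
Lemma bin_odd_le (k : nat) : 'C(k.*2.+1, k) <= 4 ^ k.
Proof.
elim: k => [|k IHk]; first by rewrite bin0.
have h1 := mul_bin_diag k.*2.+3 k.
have h2 := mul_bin_down k.*2.+2 k.
rewrite doubleS expnS; rewrite /= in h1 h2.
set x := 'C(k.*2.+2.+1, k.+1) in h1 *.
set y := 'C(k.*2.+2, k) in h1 h2.
set z := 'C(k.*2.+1, k) in h2 IHk.
have e2 : k.*2.+2 - k = k.+2 by lia.
rewrite e2 in h2.
have : k.+1 * k.+2 * x <= k.+1 * k.+2 * (4 * z).
  have -> : k.+1 * k.+2 * x = k.*2.+3 * (k.*2.+2 * z) by rewrite h2; nia.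
  nia.
rewrite leq_pmul2l // => /leq_trans; apply; lia.
Qed.

(** Strong induction: an even [n > 2] is not prime, and for [n = 2k + 1] the primes in []k + 1, 2k +
    1]] all divide ['C(2k + 1, k)], which is at most [4 ^ k]. *)
Lemma primorial_le (n : nat) : \prod_(0 <= p < n.+1 | prime p) p <= 4 ^ n.
Proof.
elim/ltn_ind: n => n IHn.
have [n_lt3|n_ge3] := ltnP n 3.
  by case: n n_lt3 {IHn} => [|[|[|]]] // _; rewrite unlock.
have [n_odd|n_even] := boolP (odd n); last first.
  have n_notpr : ~~ prime n by apply: contra n_even => /even_prime[nE|//]; rewrite nE in n_ge3.
  rewrite big_mkcond big_nat_recr //= (negPf n_notpr) muln1 -big_mkcond.
  have := IHn n.-1; rewrite prednK; last by lia.
  move=> /(_ _)/leq_trans; apply; [lia|by rewrite leq_pexp2l ?leq_pred].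
pose k := n./2.
have nE : n = k.*2.+1 by rewrite /k -[LHS]odd_double_half n_odd.
rewrite (@big_cat_nat _ _ _ k.+2) /=; [|lia|lia].
have -> : 4 ^ n = 4 ^ k.+1 * 4 ^ k by rewrite -expnD nE; congr (_ ^ _); lia.
apply: leq_mul; first by apply: IHn; lia.
apply: leq_trans (bin_odd_le k).
apply: dvdn_leq; first by rewrite bin_gt0; lia.
rewrite -big_filter; apply: prod_primes_dvd.
- by rewrite filter_uniq ?iota_uniq.
- exact: filter_all.
apply/allP=> p; rewrite mem_filter mem_index_iota => /andP[p_pr /andP[kp pn]].
have : p %| (k.*2.+1)`! by rewrite prime_dvd_fact // -nE.
have kk : k <= k.*2.+1 by lia.
rewrite -(bin_fact kk) !Euclid_dvdM // !prime_dvd_fact //.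
have -> : p <= k = false by lia.
have -> : p <= k.*2.+1 - k = false by lia.
by rewrite !orbF.
Qed.

(** From [n] to [n + 1] the right-hand side is multiplied by [2 (2n + 1) / n], which exceeds 4. *)
Lemma central_bin_ge (n : nat) : 0 < n -> 4 ^ n <= n.*2 * 'C(n.*2, n).
Proof.
elim: n => // -[_ _ //|n /(_ isT) IHn _].
have h1 := mul_bin_diag n.+1.*2.+2 n.+1.
have h2 := mul_bin_down n.+1.*2.+1 n.+1.
rewrite doubleS expnS in h1 h2 *; rewrite /= in h1 h2.
set x := 'C(n.+1.*2.+2, n.+2) in h1 *.
set y := 'C(n.+1.*2.+1, n.+1) in h1 h2.
set z := 'C(n.+1.*2, n.+1) in h2 IHn.
have e2 : n.+1.*2.+1 - n.+1 = n.+2 by lia.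
rewrite e2 in h2.
have e : n.+1.*2.+2 * x = 2 * (2 * (n.+1.*2.+1 * z)) by rewrite h2; nia.
rewrite e; nia.
Qed.

(** Legendre's formula applied to [(2n)! = 'C(2n, n) n! n!]; the sum for [n!] is extended up to [2n]
    by zero terms. *)
Lemma logn_central_bin (p n : nat) : prime p ->
  logn p 'C(n.*2, n) =
  \sum_(1 <= k < n.*2.+1) (n.*2 %/ p ^ k - (n %/ p ^ k).*2).
Proof.
move=> p_pr; have p_gt1 := prime_gt1 p_pr.
have nn : n <= n.*2 by lia.
have := congr1 (logn p) (bin_fact nn).
have -> : n.*2 - n = n by lia.
rewrite !lognM ?muln_gt0 ?fact_gt0 ?bin_gt0 // !logn_fact //.
have -> : \sum_(1 <= k < n.+1) n %/ p ^ k = \sum_(1 <= k < n.*2.+1) n %/ p ^ k.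
  rewrite [RHS](@big_cat_nat _ _ _ n.+1) //=.
  rewrite [X in _ = _ + X]big_nat [X in _ = _ + X]big1 ?addn0 // => k /andP[nk _].
  by rewrite divn_small // (leq_trans nk) // ltnW // ltn_expl.
move=> h; apply/eqP; rewrite -(eqn_add2r (\sum_(1 <= k < n.*2.+1) (n %/ p ^ k).*2)).
rewrite -big_split /=; apply/eqP.
have -> : \sum_(1 <= k < n.*2.+1) (n %/ p ^ k).*2 =
    \sum_(1 <= k < n.*2.+1) n %/ p ^ k + \sum_(1 <= k < n.*2.+1) n %/ p ^ k.
  by rewrite -big_split /=; apply: eq_bigr => k _; rewrite addnn.
rewrite h; apply: eq_bigr => k _; rewrite subnK //.
by rewrite -!muln2 mulnC leq_divRL ?expn_gt0 ?prime_gt0 // -mulnA mulnC leq_mul2r leq_trunc_div orbT.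
Qed.

(** Every term of the Legendre sum is 0 or 1, and the terms with [p ^ k > 2n] vanish. *)
Lemma central_bin_pfactor_le (p n : nat) : prime p -> 0 < n ->
  p ^ logn p 'C(n.*2, n) <= n.*2.
Proof.
move=> p_pr n_gt0; have p_gt1 := prime_gt1 p_pr.
have n2_gt0 : 0 < n.*2 by lia.
apply: leq_trans (trunc_logP p_gt1 n2_gt0); rewrite leq_exp2l //.
set T := trunc_log p n.*2; rewrite logn_central_bin //.
have -> : T = \sum_(1 <= k < T.+1) 1 by rewrite sum_nat_const_nat muln1 subn1.
have Tn : T.+1 <= n.*2.+1.
  by rewrite ltnS (leq_trans _ (trunc_logP p_gt1 n2_gt0)) // ltnW // ltn_expl.
rewrite (@big_cat_nat _ _ _ T.+1) //= [X in _ + X]big_nat_cond.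
rewrite [X in _ + X]big1 ?addn0 => [|k /andP[/andP[Tk _] _]].
  apply: leq_sum => k _; rewrite leq_subLR addn1 -ltnS.
  have pk_gt0 : 0 < p ^ k by rewrite expn_gt0 ltnW.
  by rewrite ltn_divLR //; have := divn_eq n (p ^ k); have := ltn_pmod n pk_gt0; nia.
rewrite divn_small // (leq_trans (trunc_log_ltn _ p_gt1)) //.
by rewrite leq_exp2l.
Qed.

(** Here [2n %/ p = 2] and [n %/ p = 1], so the term [k = 1] cancels; the others vanish because
    [p ^ 2 >= 3 p > 2n]. *)
Lemma logn_central_bin_eq0 (p n : nat) : prime p -> 2 < p -> p <= n ->
  n.*2 < 3 * p -> logn p 'C(n.*2, n) = 0.
Proof.
move=> p_pr p_gt2 pn np; rewrite logn_central_bin // big_nat big1 // => k.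
case: k => [//|[_|k _]].
  rewrite expn1.
  have -> : n.*2 %/ p = 2 
    by apply/eqP; rewrite eqn_leq -ltnS ltn_divLR ?leq_divRL; lia.
  suff -> : n %/ p = 1 by [].
  by apply/eqP; rewrite eqn_leq -ltnS ltn_divLR ?leq_divRL; lia.
rewrite divn_small // (@leq_trans (p ^ 2)) //; first by nia.
by rewrite leq_pexp2l // (prime_gt0).
Qed.

(** Primes below [S] contribute at most [2n] each. Primes from [S] up to [2n / 3] occur at most
    once, and the primorial bounds their product. Primes in []2n / 3, n]] that are at least [S] do
    not occur, and larger ones are excluded by assumption. *)
Lemma central_bin_le (n S : nat) : n.*2 < S ^ 2 ->
    4 < n -> (forall p, prime p -> n < p -> n.*2 < p) ->
  'C(n.*2, n) <= n.*2 ^ S * 4 ^ (n.*2 %/ 3).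
Proof.
move=> nS n_gt4 no_prime; have n_gt0 : 0 < n by lia.
set M := 'C(n.*2, n).
have M_gt0 : 0 < M by rewrite bin_gt0; lia.
have Mp p : prime p -> p %| M -> p <= n.*2.
  by move=> p_pr; rewrite /M -prime_dvd_fact // => /dvdn_trans; apply;
     apply/dvdnP; exists (n`! * (n.*2 - n)`!); rewrite mulnC bin_fact //; lia.
(* [N] is merely a common range, large enough for all the products compared below. *)
pose T := n.*2 %/ 3; pose N := M + S + n.*2.
have -> : M = \prod_(0 <= p < N.+1 | prime p) p ^ logn p M.
  rewrite -{1}(partnT M_gt0) (@widen_partn N); last by rewrite /N; lia.
  rewrite big_mkcond [RHS]big_mkcond.
  apply: eq_bigr => p _ /=; case: ifP => //.
  by rewrite lognE => ->.
have pow_le p : prime p ->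
    p ^ logn p M <= (if p < S then n.*2 else 1) * (if p < T.+1 then p else 1).
  move=> p_pr; have p_gt1 := prime_gt1 p_pr.
  have pM := central_bin_pfactor_le p_pr n_gt0; rewrite -/M in pM.
  have [pS|Sp] := ltnP p S.
    by case: ifP => _; rewrite ?muln1 // (leq_trans pM) // leq_pmulr // prime_gt0.
  have p2 : n.*2 < p ^ 2 by rewrite (leq_trans nS) // leq_exp2r.
  have lp1 : logn p M <= 1.
    by rewrite -ltnS -(ltn_exp2l _ _ p_gt1) (leq_ltn_trans pM).
  rewrite mul1n; have [pT|Tp] := ltnP p T.+1.
    by rewrite -[leqRHS]expn1 leq_exp2l.
  have np3 : n.*2 < 3 * p by rewrite mulnC -ltn_divLR.
  have [pn|np] := leqP p n; first by rewrite logn_central_bin_eq0 //; lia.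
  rewrite lognE p_pr M_gt0 /=; case: ifP => // /(Mp _ p_pr).
  by rewrite leqNgt no_prime.
apply: (@leq_trans (\prod_(0 <= p < N.+1 | prime p)
  ((if p < S then n.*2 else 1) * (if p < T.+1 then p else 1)))).
  by apply: leq_prod => p; exact: pow_le.
rewrite big_split /=; apply: leq_mul.
  have -> : n.*2 ^ S = \prod_(0 <= p < N.+1 | p < S) n.*2.
    by rewrite -(@big_nat_widen _ _ _ 0 S N.+1 xpredT) ?prod_nat_const_nat ?subn0 // /N; lia.
  rewrite big_mkcond [leqRHS]big_mkcond; apply: leq_prod => p _ /=.
  by do 2 case: ifP => _ //; lia.
apply: leq_trans (primorial_le T).
rewrite (@big_nat_widen _ _ _ 0 T.+1 N.+1) => [|]; last by rewrite /N /T; have := leq_div n.*2 3; lia.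
rewrite big_mkcond [leqRHS]big_mkcond; apply: leq_prod => p _ /=.
by case: (prime p) => //=; case: ifP.
Qed.

(** Below [2 ^ 13] a chain of primes, each at most twice the preceding one, suffices. Above, the
    lower and upper bounds on the central binomial coefficient contradict each other if there is no
    such prime. *)
Lemma bertrand (n : nat) : 0 < n -> exists p, [/\ prime p, n < p & p <= n.*2].
Proof.
move=> n_gt0.
have chain q p : prime p -> q <= n < p -> p <= q.*2 ->
    exists p, [/\ prime p, n < p & p <= n.*2].
  by move=> p_pr /andP[qn np] pq; exists p; split; rewrite // (leq_trans pq) ?leq_double.
have [n_small|n_big] := ltnP n (2 ^ 13).
  have step q p : prime p && (p <= q.*2) ->
      (n < q -> exists p, [/\ prime p, n < p & p <= n.*2]) ->
      n < p -> exists p, [/\ prime p, n < p & p <= n.*2].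
    move=> /andP[p_pr pq] IH np; have [/IH//|qn] := ltnP n q.
    by apply: (chain q p); rewrite ?qn.
  have : n < 9973 by apply: leq_trans n_small _; vm_compute.
  apply: (step 5003); first by vm_compute.
  apply: (step 2503); first by vm_compute.
  apply: (step 1259); first by vm_compute.
  apply: (step 631); first by vm_compute.
  apply: (step 317); first by vm_compute.
  apply: (step 163); first by vm_compute.
  apply: (step 83); first by vm_compute.
  apply: (step 43); first by vm_compute.
  apply: (step 23); first by vm_compute.
  apply: (step 13); first by vm_compute.
  apply: (step 7); first by vm_compute.
  apply: (step 5); first by vm_compute.
  apply: (step 3); first by vm_compute.
  apply: (step 2); first by vm_compute.
  by apply: (step 1) => //; rewrite ltnS leqNgt n_gt0.
have [/existsP [p /and3P[? ? ?]]|no] := boolP [exists p : 'I_n.*2.+1, [&& prime p, n < p & p <= n.*2]].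
  by exists p.
have no_prime p : prime p -> n < p -> n.*2 < p.
  move=> p_pr np; rewrite ltnNge; apply: contra no => pn.
  by apply/existsP; exists (Ordinal (pn : p < n.*2.+1)); rewrite /= p_pr np pn.
exfalso.
have n2_gt0 : 0 < n.*2 by lia.
(* [2 ^ j] approximates the square root of [2n] from below, so [S = 2 ^ j.+1] is admissible and the
   comparison takes place between exponents of 2. *)
pose j := (trunc_log 2 n.*2)./2.
have /andP[jn nj] : 2 ^ j.*2 <= n.*2 < 2 ^ j.+1.*2.
  have /andP[h1 h2] := @trunc_log_bounds 2 n.*2 isT n2_gt0.
  have := odd_double_half (trunc_log 2 n.*2); rewrite -/j => jE.
  apply/andP; split; [apply: leq_trans h1|apply: (leq_trans h2)].
    by rewrite leq_exp2l //; lia.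
  by rewrite leq_exp2l //; case: (odd _) jE => /=; lia.
have j_ge7 : 6 < j.
  have : 2 ^ 14 < 2 ^ j.+1.*2.
    by apply: leq_ltn_trans nj; rewrite expnS mul2n leq_double.
  by rewrite ltn_exp2l //; lia.
have n_gt4 : 4 < n by apply: leq_trans n_big.
have nS : n.*2 < (2 ^ j.+1) ^ 2 by rewrite -expnM muln2.
have hM := central_bin_le nS n_gt4 no_prime.
have : 4 ^ n <= n.*2 * (n.*2 ^ (2 ^ j.+1) * 4 ^ (n.*2 %/ 3)).
  by apply: leq_trans (central_bin_ge n_gt0) _; rewrite leq_mul2l hM orbT.
rewrite mulnA -expnS => h.
have {h} : 2 ^ n.*2 <= 2 ^ (j.+1.*2 * (2 ^ j.+1).+1 + (n.*2 %/ 3).*2).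
  have four_exp k : 2 ^ k.*2 = 4 ^ k by rewrite -mul2n expnM.
  rewrite expnD !four_exp (leq_trans h) // leq_mul2r; apply/orP; right.
  by rewrite expnM leq_exp2r // ltnW.
rewrite leq_exp2l // => h.
have h2 : 2 ^ j * 2 ^ j <= 6 * j.+1 * (2 ^ j.+1).+1.
  rewrite -expnD addnn (leq_trans jn) //.
  have := leq_divM n.*2 3; move: h; set a := (2 ^ j.+1).+1; set b := _ %/ 3.
  by clear; nia.
(* With [a = 2 ^ j], [h2] reads [a^2 <= 12 (j + 1) a + 6 (j + 1)]; since [a > 6], the factor 13 is
   enough for a contradiction. *)
have h3 : 13 * j.+1 < 2 ^ j.
  clear -j_ge7; elim: j j_ge7 => // j IHj; rewrite ltnS leq_eqVlt expnS.
  by case/orP => [/eqP<-//|/IHj]; lia.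
move: h2 h3; rewrite expnS; move: (2 ^ j) => a h2 h3.
have : a * a <= 12 * j.+1 * a + 6 * j.+1 by lia.
by have := leq_mul h3 (leqnn a); nia.
Qed.

End Bertrand.

(** * Minimum of the lattice *)

(** Newton's identities in the form of a logarithmic derivative, without division: [X^m / (X - x)]
    is the sum of the [x^i X^(m-1-i)] for [i < m] plus [x^m / (X - x)]. Summing over [x] and
    multiplying by the product leaves the remainder [r]. *)
Lemma deriv_prod_XsubC (F : comNzRingType) (s : seq F) (m : nat) :
  exists2 r : {poly F}, (size r <= size s)%N &
    'X^m * (\prod_(x <- s) ('X - x%:P))^`() =
    r + \prod_(x <- s) ('X - x%:P) *
        \sum_(i < m) (\sum_(x <- s) x ^+ i) *: 'X^(m.-1 - i).
Proof.
elim: s => [|x s [r sr IHs]].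
  exists 0; first by rewrite size_poly0.
  rewrite !big_nil derivC mulr0 add0r mul1r big1 // => i _.
  by rewrite big_nil scale0r.
set P := \prod_(y <- s) _ in IHs.
exists (('X - x%:P) * r + (x ^+ m) *: P).
  rewrite (leq_trans (size_polyD _ _)) // geq_max; apply/andP; split.
    rewrite (leq_trans (size_polyMleq _ _)) // size_XsubC /=.
    by rewrite ltnS.
  by rewrite (leq_trans (size_scale_leq _ _)) // size_prod_XsubC.
rewrite big_cons -/P derivM derivXsubC mul1r mulrDr.
rewrite [X in _ + X]mulrCA IHs.
have -> : \sum_(i < m) (\sum_(y <- x :: s) y ^+ i) *: 'X^(m.-1 - i) =
  \sum_(i < m) (x ^+ i) *: 'X^(m.-1 - i) +
  \sum_(i < m) (\sum_(y <- s) y ^+ i) *: 'X^(m.-1 - i) :> {poly F}.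
  by rewrite -big_split; apply: eq_bigr => i _; rewrite big_cons scalerDl.
have := subrXX ('X : {poly F}) x%:P m.
have -> : \sum_(i < m) 'X^(m.-1 - i) * x%:P ^+ i =
  \sum_(i < m) (x ^+ i) *: 'X^(m.-1 - i).
  by apply: eq_bigr => i _; rewrite -mul_polyC rmorphXn mulrC.
set A := \sum_(i < m) x ^+ i *: _; set B := \sum_(i < m) _.
move/(canRL (subrK _)) => ->.
rewrite -mul_polyC rmorphXn; ring.
Qed.

Lemma coefM_top (F : nzRingType) (p q : {poly F}) (a b : nat) :
  (size p <= a.+1)%N -> (size q <= b.+1)%N -> (p * q)`_(a + b) = p`_a * q`_b.
Proof.
move=> pa qb; rewrite coefM.
have lt : (a < (a + b).+1)%N by lia.
rewrite (bigD1 (Ordinal lt)) //= addKn big1 ?addr0 // => i ia.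
have [ai|ia'] := ltnP a i.
  by rewrite [p`_i]nth_default ?mul0r // (leq_trans pa).
rewrite [q`_ _]nth_default ?mulr0 // (leq_trans qb) //.
have : (i != a :> nat) by [].
by lia.
Qed.

(** Equal power sums eliminate [S] between the two Newton identities, so
    [X^m (P' Q - P Q') = r1 Q - P r2], whose right side has degree below [2k]. If [D = P - Q] were
    nonzero of degree [d < k], the left side would have degree at least [2k], as [k - d] is
    invertible in characteristic [p > k]. *)
Lemma prod_XsubC_eq_power_sums (p : nat) (F : fieldType) (s t : seq F) (m : nat) :
    p \in [pchar F] -> size s = size t -> (size s < m)%N -> (size s < p)%N ->
    (forall i, (i < m)%N -> \sum_(x <- s) x ^+ i = \sum_(x <- t) x ^+ i) ->
  \prod_(x <- s) ('X - x%:P) = \prod_(x <- t) ('X - x%:P).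
Proof.
move=> pF st sm sp sums.
have [r1 sr1] := deriv_prod_XsubC s m.
have [r2 sr2] := deriv_prod_XsubC t m.
have -> : \sum_(i < m) (\sum_(x <- t) x ^+ i) *: 'X^(m.-1 - i) =
  \sum_(i < m) (\sum_(x <- s) x ^+ i) *: 'X^(m.-1 - i) :> {poly F}.
  by apply: eq_bigr => i _; rewrite sums.
have := size_prod_XsubC s id; have := size_prod_XsubC t id.
have := monic_prod_XsubC s xpredT id; have := monic_prod_XsubC t xpredT id.
rewrite -st in sr2 *.
set P := \prod_(x <- s) _; set Q := \prod_(x <- t) _; set S := \sum_(i < m) _.
set k := size s in sm sp sr1 sr2 *.
move=> Qm Pm Qs Ps eQ eP.
apply/eqP; rewrite -subr_eq0; apply/negPn/negP => D_neq0.
set D := P - Q in D_neq0.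
have PE : P = D + Q by rewrite subrK.
have Dk : (size D <= k)%N.
  apply/leq_sizeP => j; rewrite leq_eqVlt coefB => /orP[/eqP<-|kj].
    have -> : P`_k = 1 by rewrite -(monicP Pm) lead_coefE Ps.
    have -> : Q`_k = 1 by rewrite -(monicP Qm) lead_coefE Qs.
    by rewrite subrr.
  by rewrite !nth_default ?subr0 ?Ps ?Qs.
pose d := (size D).-1.
have Ds : size D = d.+1 by rewrite prednK // size_poly_gt0.
(* The extra factor [X] turns derivatives into Euler operators, which do not lower the degree bounds
   and multiply the coefficient of index [a] by [a]. *)
have key : 'X^m * ('X * D^`() * Q - D * ('X * Q^`())) = 'X * (r1 * Q - P * r2).
  have -> : 'X^m * ('X * D^`() * Q - D * ('X * Q^`())) =
     'X * ('X^m * P^`() * Q - P * ('X^m * Q^`())).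
    by rewrite PE (derivD D Q); ring.
  by rewrite eP eQ; ring.
have := congr1 (fun q : {poly F} => q`_(m + (d + k))) key.
have -> : ('X * (r1 * Q - P * r2))`_(m + (d + k)) = 0.
  apply: nth_default; rewrite (leq_trans (size_polyMleq _ _)) // size_polyX /=.
  suff : (size (r1 * Q - P * r2)%R <= k + k)%N.
    by move=> h; rewrite (leq_ltn_trans h) // addnA ltn_add2r ltn_addr.
  rewrite (leq_trans (size_polyD _ _)) // size_polyN geq_max.
  have sizeM (q q' : {poly F}) : (size q <= k)%N -> size q' = k.+1 ->
      (size (q * q')%R <= k + k)%N.
    by move=> qk q'k; rewrite (leq_trans (size_polyMleq _ _)) // q'k; lia.
  by rewrite sizeM // mulrC sizeM.
have size_XD (q : {poly F}) a : (size q <= a.+1)%N -> (size ('X * q^`())%R <= a.+1)%N.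
  move=> qa; apply/leq_sizeP => j aj; rewrite coefXM; case: j aj => //= j aj.
  by rewrite coef_deriv nth_default ?mul0rn // (leq_trans qa).
have coef_XD (q : {poly F}) a : ('X * q^`())`_a = q`_a *+ a.
  by rewrite coefXM; case: a => [|a]; rewrite ?mulr0n ?coef_deriv.
rewrite coefXnM ifF; last by lia.
(* The coefficient of index [d + k] is [d - k] times the leading coefficient of [D], and
   [0 < k - d < p]. *)
rewrite addKn coefB !coefM_top ?size_XD ?Ds ?Qs // !coef_XD.
have -> : Q`_k = 1 by rewrite -(monicP Qm) lead_coefE Qs.
rewrite mulr1 mulr_natr.
have dk : (d < k)%N by rewrite -Ds.
move/eqP; rewrite -opprB oppr_eq0 -mulrnBr 1?ltnW // -mulr_natr mulf_eq0.
rewrite -(dvdn_pcharf pF) gtnNdvd ?subn_gt0 //; last by lia.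
by rewrite orbF -[d]/(size D).-1 -lead_coefE lead_coef_eq0 (negPf D_neq0).
Qed.

(* The Euler operator ['X * _^`()] sends [\sum_j q_j X^j] to [\sum_j j q_j X^j],
   so iterating it and evaluating at 1 gives the moments of the coefficients. *)
Lemma moments_eq0 (A : comNzRingType) (g : {poly A}) (N m i : nat) :
    (i < m)%N -> (size (('X - 1) ^+ m * g)%R <= N)%N ->
  \sum_(j < N) (('X - 1) ^+ m * g)`_j * j%:R ^+ i = 0.
Proof.
move=> im; set f := _ * g => fN.
pose E (q : {poly A}) := 'X * q^`().
have coefE q a j : (iter a E q)`_j = q`_j * j%:R ^+ a.
  elim: a => [|a IHa]; first by rewrite mulr1.
  rewrite iterS coefXM; case: j IHa => [|j] IHa.
    by rewrite exprS mul0r mulr0.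
  by rewrite coef_deriv IHa exprSr mulrA mulr_natr.
(* Each application of [E] lowers the order of vanishing at 1 by at most one. *)
have factor a : (a <= m)%N ->
    exists g', iter a E f = ('X - 1) ^+ (m - a) * g'.
  elim: a => [|a IHa] am; first by exists g; rewrite subn0.
  have [g' /= ->] := IHa (ltnW am).
  have -> : (m - a)%N = (m - a.+1).+1 by lia.
  exists ('X * (g' *+ (m - a.+1).+1 + ('X - 1) * g'^`())).
  rewrite /E derivM deriv_exp derivB derivX -polyC1 derivC subr0 polyC1 mul1r /=.
  by rewrite mulrnAl -mulrnAr exprSr -mulrA -mulrDr mulrCA.
have [g' fE] := factor i (ltnW im).
transitivity (iter i E f).[1].
  rewrite (@horner_coef_wide _ N).
    by apply: eq_bigr => j _; rewrite coefE expr1n mulr1.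
  by apply/leq_sizeP => j jN; rewrite coefE nth_default ?mul0r // (leq_trans fN).
rewrite fE hornerM horner_exp !hornerE subrr expr0n.
by rewrite subn_eq0 leqNgt im mul0r.
Qed.

Definition pos_part (a : int) : nat := if a is Posz k then k else 0.
Definition neg_part (a : int) : nat := if a is Negz k then k.+1 else 0.

Lemma pos_part_sub_neg_part (a : int) : a = (pos_part a)%:Z - (neg_part a)%:Z.
Proof. by case: a => k; rewrite /= ?subr0 // NegzE sub0r. Qed.

(** A multiset with multiplicities [c], written as a sequence: its power sums are the moments of
    [c]. *)
Definition mult_seq (F : nzRingType) (N : nat) (c : nat -> nat) : seq F :=
  flatten [seq nseq (c j) j%:R | j <- iota 0 N].

Lemma sum_exp_mult_seq (F : nzRingType) (N : nat) (c : nat -> nat) (i : nat) :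
  \sum_(x <- mult_seq F N c) x ^+ i = \sum_(j < N) (c j)%:R * j%:R ^+ i.
Proof.
rewrite big_flatten big_map -{1}[N]subn0 big_mkord /=.
by apply: eq_bigr => j _; rewrite big_nseq iter_addr_0 mulr_natl.
Qed.

Lemma size_mult_seq (F : nzRingType) (N : nat) (c : nat -> nat) :
  size (mult_seq F N c) = \sum_(j < N) c j.
Proof.
rewrite size_flatten sumnE !big_map -{1}[N]subn0 big_mkord.
by apply: eq_bigr => j _; rewrite size_nseq.
Qed.

Lemma natr_inj_pchar (p : nat) (F : nzRingType) (j k : nat) :
  p \in [pchar F] -> (j < p)%N -> (k < p)%N -> j%:R = k%:R :> F -> j = k.
Proof.
move=> pF; wlog jk : j k / (j <= k)%N => [W jp kp|_ kp jkF].
  by case/orP: (leq_total j k) => jk /esym e; [apply: W|symmetry; apply: W].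
have /eqP : (k - j)%:R = 0 :> F by rewrite natrB // jkF subrr.
rewrite -(dvdn_pcharf pF) => /dvdnP[q kj].
by apply/eqP; rewrite eqn_leq jk; case: q kj => [|q]; nia.
Qed.

(** Indices below [N <= p] stay distinct in characteristic [p], so membership detects the support of
    [c]. *)
Lemma mem_mult_seq (p : nat) (F : nzRingType) (N j : nat) (c : nat -> nat) :
  p \in [pchar F] -> (N <= p)%N -> (j < N)%N ->
  (j%:R \in mult_seq F N c) = (0 < c j)%N.
Proof.
move=> pF Np jN; apply/flatten_mapP/idP => [[k]|cj]; last first.
  by exists j; rewrite ?mem_iota // mem_nseq cj /=.
rewrite mem_iota add0n mem_nseq => /andP[_ kN] /andP[ck /eqP jk].
by rewrite (natr_inj_pchar pF _ _ jk) // (leq_trans _ Np).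
Qed.

Lemma craig_norm_ge (p n m : nat) (f : {poly int}) (g : {poly 'F_p}) :
    prime p -> (n < p)%N -> (m <= p)%N -> (size f <= n.+1)%N -> f != 0 ->
    f.[1] = 0 -> map_poly intr f = ('X - 1) ^+ m * g ->
  (m.*2)%:Z <= \sum_(j < n.+1) f`_j ^+ 2.
Proof.
move=> p_pr np mp fn f_neq0 f1 fE.
have pF : p \in [pchar 'F_p] by rewrite pchar_Fp.
pose s := mult_seq 'F_p n.+1 (fun j => pos_part f`_j).
pose t := mult_seq 'F_p n.+1 (fun j => neg_part f`_j).
have st : size s = size t.
  move: f1; rewrite (horner_coef_wide _ fn) => f1.
  apply/eqP; rewrite !size_mult_seq -eqz_nat -subr_eq0 !(big_morph Posz PoszD (erefl _)).
  rewrite -sumrB -[X in _ == X]f1; apply/eqP; apply: eq_bigr => j _.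
  by rewrite -pos_part_sub_neg_part expr1n mulr1.
(* An integer satisfies [|a| <= a^2], so the squared norm is at least the total mass
   [size s + size t]. *)
suff ms : (m <= size s)%N.
  apply: (@le_trans _ _ (size s + size t)%:Z); first by rewrite lez_nat -st; lia.
  rewrite !size_mult_seq -big_split /= (big_morph Posz PoszD (erefl _)).
  apply: ler_sum => j _; case: (f`_j) => k /=; rewrite ?NegzE; nia.
rewrite leqNgt; apply/negP => sm.
have sums i : (i < m)%N -> \sum_(x <- s) x ^+ i = \sum_(x <- t) x ^+ i.
  move=> im; rewrite !sum_exp_mult_seq; apply: subr0_eq; rewrite -sumrB.
  have := @moments_eq0 _ g n.+1 _ _ im; rewrite -fE (leq_trans (size_poly _ _) fn) => /(_ isT) sum0.
  rewrite -[RHS]sum0; apply: eq_bigr => j _.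
  by rewrite coef_map /= -mulrBl [in RHS](pos_part_sub_neg_part f`_j) rmorphB.
have eqst := prod_XsubC_eq_power_sums pF st sm (leq_trans sm mp) sums.
have mem_st x : (x \in s) = (x \in t).
  by rewrite -!root_prod_XsubC eqst.
(* A coefficient never has both parts positive, so equal supports force every coefficient to
   vanish. *)
case/negP: f_neq0; apply/eqP/polyP => j; rewrite coef0.
have [jn|nj] := ltnP j n.+1; last by rewrite nth_default // (leq_trans fn).
have := mem_st j%:R; rewrite !(mem_mult_seq _ pF np jn).
by case: (f`_j) => [[|k]|k].
Qed.

(** * Gram determinant *)

(** Both sides, multiplied by [X - 1], equal [X^(n+1) - 1]; on the right [X] is expanded as
    [1 + (X - 1)]. *)
Lemma all_one_polyE (n : nat) :
  \sum_(j < n.+1) 'X^j =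
  \sum_(k < n.+1) ('X - 1) ^+ k *+ 'C(n.+1, k.+1) :> {poly int}.
Proof.
apply: (@mulfI _ ('X - 1)); first by rewrite -size_poly_eq0 -polyC1 size_XsubC.
have := subrXX ('X : {poly int}) 1 n.+1; rewrite expr1n.
under eq_bigr do rewrite expr1n mulr1.
have -> : \sum_(i < n.+1) ('X : {poly int}) ^+ (n.+1.-1 - i) = \sum_(j < n.+1) 'X^j.
  by rewrite (reindex_inj rev_ord_inj) /=; apply: eq_bigr => i _; rewrite subSS subKn // -ltnS.
move=> <-; rewrite mulr_sumr.
have -> : ('X : {poly int}) ^+ n.+1 = (1 + ('X - 1)) ^+ n.+1 by rewrite addrCA subrr addr0.
rewrite exprDn big_ord_recl /= expr1n mul1r expr0 bin0 mulr1n addrC addKr.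
by apply: eq_bigr => i _; rewrite expr1n mul1r /bump /= exprS mulrnAr.
Qed.

Lemma size_X_sub_1_exp (k : nat) : size (('X - 1) ^+ k : {poly int}) = k.+1.
Proof. by rewrite -polyC1 size_exp_XsubC. Qed.

Section Gram.
Variables (R : realType) (n : nat).

Let W : 'M[R]_(1 + n, n.+1) :=
  \matrix_(k, j) (((('X - 1) ^+ k : {poly int})`_j)%:~R).
(** With [m = 0] no generator is rescaled, so the rows are the plain powers of [X - 1] of exponents
    1 to [n]. *)
Let A : 'M[R]_(n, n.+1) := craig_basis R n 0 0.
Let u : 'rV[R]_n.+1 := const_mx 1.

Let det_W : \det W = 1.
Proof.
rewrite det_trig; last first.
  apply/is_trig_mxP => i j ij; rewrite mxE nth_default //.
  by rewrite size_X_sub_1_exp.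
rewrite big1 // => i _; rewrite mxE.
have /monicP : (('X - 1) ^+ i : {poly int}) \is monic.
  by rewrite -polyC1 monic_exp // monicXsubC.
by rewrite lead_coefE size_X_sub_1_exp => ->.
Qed.

Let dsubmx_W : dsubmx W = A.
Proof. by apply/matrixP => i j; rewrite !mxE. Qed.

Let all_one_W :
  u = (\row_(k < 1 + n) 'C(n.+1, k.+1)%:R) *m W.
Proof.
apply/matrixP => i j; rewrite !mxE.
under eq_bigr => k _ do rewrite !mxE.
transitivity (((\sum_(j < n.+1) 'X^j : {poly int})`_j)%:~R : R).
  rewrite coef_sum (bigD1 j) //= coefXn eqxx big1 ?addr0 // => k kj.
  by rewrite coefXn -[_ == _]/(j == k) eq_sym (negPf kj).
rewrite all_one_polyE coef_sum rmorph_sum /=; apply: eq_bigr => k _.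
by rewrite coefMn rmorphMn /= mulr_natl.
Qed.

Lemma det_gram_shifted_powers : \det (A *m A^T) = n.+1%:R.
Proof.
(* [C] replaces the first row of [W] by the all-one vector [u], whose coordinates in the rows of [W]
   are binomial coefficients, the first one being [n + 1]. *)
pose C : 'M[R]_(1 + n) :=
  block_mx (n.+1%:R)%:M (\row_(k < n) 'C(n.+1, k.+2)%:R) 0 1%:M.
pose M : 'M[R]_(1 + n) := col_mx u A.
have ME : M = C *m W.
  rewrite -[W]vsubmxK /C mul_block_col dsubmx_W mul0mx mul1mx add0r /M.
  congr col_mx; rewrite all_one_W -[W in LHS]vsubmxK -[X in X *m _]hsubmxK mul_row_col dsubmx_W.
  have -> : lsubmx (\row_(k < 1 + n) 'C(n.+1, k.+1)%:R) = (n.+1%:R)%:M :> 'M[R]_1.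
    by apply/matrixP => i j; rewrite !mxE !ord1 /= bin1.
  have -> // : rsubmx (\row_(k < 1 + n) 'C(n.+1, k.+1)%:R) =
    \row_(k < n) 'C(n.+1, k.+2)%:R :> 'rV[R]_n.
  by apply/matrixP => i j; rewrite !mxE.
have detM : \det M = n.+1%:R.
  by rewrite ME det_mulmx det_W mulr1 det_ublock det1 mulr1 det_scalar1.
(* The product of [u] with a row of [A] is the value at 1 of a positive power of [X - 1]. *)
have uA : u *m A^T = 0.
  apply/matrixP => i j; rewrite !mxE.
  under eq_bigr => k _ do rewrite !mxE mul1r /craig_generator ltn0 mulr1n.
  rewrite -rmorph_sum /=.
  have := @horner_coef_wide _ n.+1 (('X - 1) ^+ j.+1 : {poly int}) 1.
  rewrite size_X_sub_1_exp ltnS => /(_ (ltn_ord j)).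
  rewrite horner_exp !hornerE subrr expr0n /= => h.
  suff -> : \sum_(k < n.+1) (('X - 1) ^+ j.+1 : {poly int})`_k = 0 by [].
  by symmetry; apply: (etrans h); apply: eq_bigr => k _; rewrite expr1n mulr1.
have Au : A *m u^T = 0 by rewrite -[LHS]trmxK trmx_mul trmxK uA trmx0.
have uu : u *m u^T = (n.+1%:R)%:M.
  apply/matrixP => i j; rewrite !mxE !ord1.
  under eq_bigr => k _ do rewrite !mxE mulr1.
  by rewrite sumr_const card_ord.
(* [M *m M^T] is block diagonal with blocks [n + 1] and [A *m A^T], and its determinant is
   [(n + 1)^2]. *)
have := congr1 determinant (erefl (M *m M^T)).
rewrite {1}det_mulmx det_tr detM /M tr_col_mx mul_col_row uu uA Au.
rewrite det_ublock det_scalar1 => /mulfI -> //.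
Qed.

End Gram.

(** Exactly the [m - 1] rows of exponents 1 to [m - 1] are scaled by [l], and each scaling enters
    the Gram determinant squared. *)
Lemma det_gram_craig (R : realType) (n m l : nat) : (0 < m <= n)%N ->
  \det (craig_basis R n m l *m (craig_basis R n m l)^T) =
  (l%:R ^+ (m - 1)) ^+ 2 * n.+1%:R.
Proof.
move=> /andP[m_gt0 mn].
pose D : 'M[R]_n := diag_mx (\row_i (if (i.+1 < m)%N then l else 1)%:R).
have -> : craig_basis R n m l = D *m craig_basis R n 0 0.
  rewrite mul_diag_mx; apply/matrixP => i j; rewrite !mxE /craig_generator ltn0.
  by rewrite mulr1n coefMn rmorphMn /= mulr_natl.
rewrite trmx_mul tr_diag_mx mulmxA -(mulmxA D) 2!det_mulmx det_gram_shifted_powers.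
rewrite det_diag; have -> : \prod_(i < n) (\row_i (if (i.+1 < m)%N then l else 1)%:R) 0 i = l%:R ^+ (m - 1) :> R.
  under eq_bigr => i _ do rewrite mxE.
  rewrite -(big_mkord xpredT (fun i => (if (i.+1 < m)%N then l else 1)%:R : R)).
  rewrite (@big_cat_nat _ _ _ (m - 1)) //=; last by lia.
  rewrite [X in _ * X]big_nat [X in _ * X]big1 ?mulr1 => [|i im].
    rewrite big_nat (eq_bigr (fun=> l%:R)) => [|i im].
      by rewrite -big_nat prodr_const_nat subn0.
    by rewrite ifT //; lia.
  by rewrite ifF //; lia.
by rewrite mulrAC expr2.
Qed.

Lemma craig_basis_free (R : realType) (n m l : nat) : (0 < m <= n)%N -> (0 < l)%N ->
  row_free (craig_basis R n m l).
Proof.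
move=> mn l_gt0; set B := craig_basis R n m l.
have : B *m B^T \in unitmx.
  rewrite unitmxE det_gram_craig // unitfE mulf_neq0 ?expf_neq0 //.
  by rewrite ?pnatr_eq0 -?lt0n.
rewrite -row_free_unit => /eqP rk; rewrite /row_free eqn_leq rank_leq_row /=.
by have := mxrankM_maxl B B^T; rewrite rk.
Qed.

(** * Volume of the Euclidean ball *)

Section Integral.
Variable R : realType.
Let mu := @lebesgue_measure R.

(* [ge0_le_integral] asks for measurability, which is not available for the
   sections of an arbitrary set. *)
Lemma ge0_le_integral_setT (f g : R -> \bar R) :
  (forall x, 0 <= f x)%E -> (forall x, f x <= g x)%E ->
  (\int[mu]_x f x <= \int[mu]_x g x)%E.
Proof.
move=> f0 fg; have g0 x : (0 <= g x)%E by exact: le_trans (fg x).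
rewrite !ge0_integralTE //; apply: le_ereal_sup => _ [h hf <-].
by exists h => // x; exact: le_trans (fg x).
Qed.

Lemma lebesgue_volume_ge0 (n : nat) (A : set 'rV[R]_n) :
  (0 <= lebesgue_volume A)%E.
Proof.
elim: n A => [A|n IHn A] /=; first by rewrite lee_fin indicE.
exact: integral_ge0.
Qed.

Lemma le_lebesgue_volume (n : nat) (A B : set 'rV[R]_n) :
  A `<=` B -> (lebesgue_volume A <= lebesgue_volume B)%E.
Proof.
elim: n A B => [A B AB|n IHn A B AB] /=.
  rewrite lee_fin !indicE ler_nat; case: (boolP (0 \in A)) => //=.
  by rewrite inE => /AB B0; rewrite mem_set.
apply: ge0_le_integral_setT => x; first exact: lebesgue_volume_ge0.
by apply: IHn => v; exact: AB.
Qed.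

Lemma lebesgue_volume0 (n : nat) : lebesgue_volume (set0 : set 'rV[R]_n) = 0%E.
Proof.
elim: n => [|n IHn] /=; first by rewrite indic0.
by rewrite (eq_integral (cst 0%E)) ?integral0 // => x _; rewrite set0E IHn.
Qed.

Lemma integral_horner_deriv (p : {poly R}) (a b : R) : a < b ->
  (\int[mu]_(x in `[a, b]) (p^`().[x])%:E = (p.[b] - p.[a])%:E)%E.
Proof.
move=> ab; rewrite (@continuous_FTC2 _ _ (horner p)) //.
- by apply: continuous_subspaceT => x; exact: continuous_horner.
- split => [x _||]; first exact: derivable_horner.
  + by apply: cvg_at_right_filter; exact: continuous_horner.
  + by apply: cvg_at_left_filter; exact: continuous_horner.
- by move=> x _; rewrite derivE.
Qed.

End Integral.

Section Ball.
Variable R : realType.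
Implicit Types r x : R.

Definition eball n r : set 'rV[R]_n := [set v | enorm v <= r].
Arguments eball : clear implicits.

Lemma enorm_row_mx n x (v : 'rV[R]_n) :
  enorm (row_mx x%:M v) = Num.sqrt (x ^+ 2 + enorm v ^+ 2).
Proof.
rewrite /enorm sqr_sqrtr; last by apply: sumr_ge0 => j _; exact: sqr_ge0.
rewrite big_split_ord big_ord1 /= row_mxEl mxE eqxx mulr1n.
by congr (Num.sqrt (_ + _)); apply: eq_bigr => j _; rewrite row_mxEr.
Qed.

Lemma enorm_ge0 n (v : 'rV[R]_n) : 0 <= enorm v.
Proof. exact: sqrtr_ge0. Qed.

Lemma ball_section n r x : 0 <= r ->
  [set v : 'rV[R]_n | enorm (row_mx x%:M v) <= r] =
  if `|x| <= r then eball n (Num.sqrt (r ^+ 2 - x ^+ 2)) else set0.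
Proof.
move=> r0; have sqrt_le (a : R) : (Num.sqrt a <= r) = (a <= r ^+ 2).
  by rewrite -[r in LHS]ger0_norm // -sqrtr_sqr ler_sqrt ?sqr_ge0.
apply/seteqP; split => v /=; rewrite enorm_row_mx sqrt_le.
  move=> xvr; have x_le : x ^+ 2 <= r ^+ 2 by apply: le_trans xvr; rewrite lerDl sqr_ge0.
  rewrite ifT; last by rewrite -(ler_pXn2r (ltn0Sn 1)) ?nnegrE // real_normK ?num_real.
  by rewrite /eball /= -[leLHS]ger0_norm ?enorm_ge0 // -sqrtr_sqr ler_wsqrtr // lerBrDl.
case: ifP => // xr; rewrite /eball /= => vr; rewrite -lerBrDl.
rewrite -[leRHS]sqr_sqrtr; first by rewrite ler_pXn2r ?nnegrE ?enorm_ge0 ?sqrtr_ge0.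
by rewrite subr_ge0 -[x ^+ 2]real_normK ?num_real // ler_pXn2r ?nnegrE.
Qed.

(** A comparison with the cube of side [2r]. It makes the volume finite, so that [fine] in
    [unit_ball_volume] returns the true value. *)
Lemma ball_volume_le n r : 0 <= r ->
  (lebesgue_volume (eball n r) <= ((2 * r) ^+ n)%:E)%E.
Proof.
elim: n r => [|n IHn] r r0 /=.
  by rewrite lee_fin indicE expr0 lern1 leq_b1.
apply: le_trans.
  apply: (@ge0_le_integral_setT _ _ ((cst ((2 * r) ^+ n)%:E) \_ `[- r, r])) => x.
    exact: lebesgue_volume_ge0.
  rewrite ball_section // patchE.
  have -> : (x \in `[- r, r]%classic) = (`|x| <= r).
    by rewrite mem_setE in_itv /= ler_norml.
  case: ifP => [xr|_]; last by rewrite lebesgue_volume0.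
  apply: le_trans (IHn _ r0); apply: le_lebesgue_volume => v /= /le_trans; apply.
  rewrite -[leRHS]ger0_norm // -sqrtr_sqr ler_wsqrtr // gerBl sqr_ge0 //.
rewrite -integral_mkcond integral_cst // exprSr EFinM.
apply: lee_wpmul2l; first by rewrite lee_fin exprn_ge0 // mulr_ge0.
rewrite [leLHS](_ : _ = @lebesgue_measure R `[- r, r]) // lebesgue_measure_itv /=.
case: ifP => _; last by rewrite lee_fin mulr_ge0.
by rewrite -EFinB lee_fin opprK mulr2n mulrDl mul1r.
Qed.

(** The factor is the integral of [1 - (n' + 2) x^2 / 2] between its two zeros. *)
Fixpoint ball_const (n : nat) : R :=
  if n is n'.+1 then ball_const n' * (4 / 3 * Num.sqrt (2 / n'.+2%:R)) else 1.

Lemma ball_const_ge0 n : 0 <= ball_const n.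
Proof. by elim: n => //= n IHn; rewrite !mulr_ge0 ?sqrtr_ge0. Qed.

(** Bernoulli's inequality for the integer exponent [uphalf n]; rounding [n / 2] up only decreases
    the power, the base being at most 1. *)
Lemma bernoulli_sqrt n (y : R) : 0 <= y <= 1 ->
  1 - n.+2%:R / 2 * y <= Num.sqrt (1 - y) ^+ n.
Proof.
move=> /andP[y0 y1]; have y1' : 0 <= 1 - y by rewrite subr_ge0.
have n2 : (n <= (uphalf n).*2 <= n.+1)%N.
  by rewrite uphalf_half; have := odd_double_half n; case: (odd n) => /=; lia.
have bern k : 1 - k%:R * y <= (1 - y) ^+ k.
  elim: k => [|k IHk]; first by rewrite mul0r subr0.
  rewrite exprS -natr1; apply: le_trans (ler_wpM2l y1' IHk).
  by have : 0 <= k%:R * y ^+ 2 :> R by [rewrite mulr_ge0 ?sqr_ge0]; nra.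
apply: (@le_trans _ _ (1 - (uphalf n)%:R * y)).
  rewrite lerD2l lerN2 ler_wpM2r // ler_pdivlMr // -natrM ler_nat muln2.
  by case/andP: n2 => _ /leq_trans; apply.
apply: (le_trans (bern _)).
rewrite -{1}(sqr_sqrtr y1') -exprM; apply: ler_wiXn2l.
- exact: sqrtr_ge0.
- by rewrite -[leRHS]sqrtr1 ler_wsqrtr // gerBl.
- by rewrite mul2n; case/andP: n2.
Qed.

Lemma ball_volume_ge n r : 0 <= r ->
  ((ball_const n * r ^+ n)%:E <= lebesgue_volume (eball n r))%E.
Proof.
elim: n r => [|n IHn] r r0.
  rewrite /= lee_fin expr0 mulr1 indicE mem_set //=.
  by rewrite /eball /= /enorm big_ord0 sqrtr0.
(* Radius 0 is set apart because the slices are rescaled by [1 / r]. *)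
move: r0; rewrite le_eqVlt => /predU1P[<-|r0].
  by rewrite expr0n mulr0; exact: lebesgue_volume_ge0.
(* [c] is the positive zero of [1 - N (x / r)^2], the lower bound for the slice at [x]; beyond it
   the slice is bounded below by 0. *)
pose N : R := n.+2%:R / 2.
pose c := r * Num.sqrt (2 / n.+2%:R).
have N_gt0 : 0 < N by rewrite divr_gt0 // ltr0n.
have c_gt0 : 0 < c by rewrite mulr_gt0 // sqrtr_gt0 divr_gt0 // ltr0n.
have c2 : N * c ^+ 2 = r ^+ 2.
  rewrite exprMn sqr_sqrtr ?divr_ge0 ?ler0n // /N; field.
  by rewrite -natrD pnatr_eq0.
have cr : c <= r.
  have : c ^+ 2 <= r ^+ 2.
    by rewrite -c2 ler_peMl ?sqr_ge0 // /N ler_pdivlMr // mul1r ler_nat.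
  by rewrite ler_pXn2r // nnegrE ltW.
pose K := ball_const n * r ^+ n.
have K_ge0 : 0 <= K by rewrite mulr_ge0 ?ball_const_ge0 ?exprn_ge0 // ltW.
(* An antiderivative of [K (1 - N (x / r)^2)]. *)
pose p : {poly R} := K *: ('X - (N / r ^+ 2 / 3) *: 'X^3).
have pE x : p^`().[x] = K * (1 - N * (x / r) ^+ 2).
  rewrite /p derivZ derivB derivX derivZ derivXn !hornerE /=; field.
  by rewrite gt_eqF.
have p_eval x : p.[x] = K * (x - N / r ^+ 2 / 3 * x ^+ 3) by rewrite /p !hornerE.
have c3 : N / r ^+ 2 * c ^+ 3 = c.
  rewrite (_ : _ * _ = N * c ^+ 2 / r ^+ 2 * c); last by ring.
  by rewrite c2 divff ?mul1r // expf_neq0 // gt_eqF.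
have intE : (\int[@lebesgue_measure R]_(x in `[(- c)%R, c]) (p^`().[x])%:E =
    (ball_const n.+1 * r ^+ n.+1)%:E)%E.
  rewrite integral_horner_deriv ?gtrN //; congr EFin; rewrite !p_eval.
  transitivity (K * (2 * c - 2 / 3 * (N / r ^+ 2 * c ^+ 3))); first by ring.
  by rewrite c3 /K /c /= exprS; move: (Num.sqrt _) => s; field.
have xcr x : `|x| <= c -> N * (x / r) ^+ 2 <= 1.
  move=> xc; rewrite expr_div_n mulrA ler_pdivrMr ?exprn_gt0 // mul1r -c2.
  by rewrite ler_pM2l // -[x ^+ 2]real_normK ?num_real // ler_pXn2r // nnegrE ltW.
rewrite -intE integral_mkcond /=; apply: ge0_le_integral_setT => x; rewrite patchE.
  case: ifP => // xc; rewrite lee_fin pE.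
  move: xc; rewrite mem_setE in_itv /= -ler_norml => /xcr xc.
  by rewrite mulr_ge0 // subr_ge0.
rewrite mem_setE in_itv /= -ler_norml; case: ifP => [xc|_]; last exact: lebesgue_volume_ge0.
rewrite ball_section ?(ltW r0) // (le_trans xc cr).
apply: le_trans (IHn _ (sqrtr_ge0 _)).
rewrite lee_fin pE /K -mulrA ler_wpM2l ?ball_const_ge0 //.
have -> : r ^+ 2 - x ^+ 2 = r ^+ 2 * (1 - (x / r) ^+ 2) by field; rewrite gt_eqF.
set y := (x / r) ^+ 2; rewrite sqrtrM ?sqr_ge0 // sqrtr_sqr gtr0_norm // exprMn.
rewrite ler_wpM2l ?exprn_ge0 ?(ltW r0) //; apply: bernoulli_sqrt; rewrite /y.
rewrite sqr_ge0 /= -real_normK ?num_real // expr_le1 // normf_div (gtr0_norm r0).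
by rewrite ler_pdivrMr // mul1r (le_trans xc).
Qed.

End Ball.

(** * Density *)

Section Craig.
Variables (R : realType) (n m p : nat).
Hypotheses (p_pr : prime p) (n_lt_p : (n < p)%N).
Hypotheses (m_gt0 : (0 < m)%N) (m_le_n : (m <= n)%N).

Let B : 'M[R]_(n, n.+1) := craig_basis R n m p.

Lemma craig_lattice_norm_ge (v : 'rV[R]_n.+1) :
  (lattice_of B `\ 0) v -> Num.sqrt (2 * m%:R) <= enorm v.
Proof.
move=> [[z _ <-] zB_neq0].
pose f : {poly int} := \sum_(i < n) z 0 i *: craig_generator m p i.+1.
have vE j : (map_mx intr z *m B) 0 j = (f`_j)%:~R.
  rewrite !mxE coef_sum rmorph_sum; apply: eq_bigr => i _.
  by rewrite !mxE coefZ rmorphM.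
have f_size : (size f <= n.+1)%N.
  apply: (leq_trans (size_sum _ _ _)); apply/bigmax_leqP => i _.
  apply: (leq_trans (size_scale_leq _ _)); rewrite /craig_generator.
  by rewrite -scaler_nat (leq_trans (size_scale_leq _ _)) // size_X_sub_1_exp ltnS.
have f_neq0 : f != 0.
  apply/eqP => f0; apply: zB_neq0; apply/matrixP => i j.
  by rewrite ord1 vE f0 coef0 mxE.
have f1 : f.[1] = 0.
  rewrite /f horner_sum big1 // => i _.
  by rewrite hornerZ hornerMn horner_exp !hornerE subrr expr0n mul0rn mulr0.
(* Modulo [p] the generators of exponent below [m] vanish, and the others are divisible by
   [(X - 1)^m]. *)
pose g : {poly 'F_p} := \sum_(i < n)
  (if (i.+1 < m)%N then 0 else (z 0 i)%:~R *: ('X - 1) ^+ (i.+1 - m)).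
have fE : map_poly intr f = ('X - 1) ^+ m * g.
  rewrite /f rmorph_sum mulr_sumr; apply: eq_bigr => i _ /=.
  rewrite map_polyZ /craig_generator rmorphMn rmorphXn rmorphB /= map_polyX rmorph1.
  case: ltnP => im; last by rewrite -scalerAr -exprD subnKC.
  by rewrite -scaler_nat pchar_Fp_0 // scale0r scaler0 mulr0.
have := craig_norm_ge p_pr n_lt_p (leq_trans m_le_n (ltnW n_lt_p)) f_size f_neq0 f1 fE.
rewrite -(ler_int R) => norm_ge; rewrite ler_wsqrtr //.
rewrite -natrM mul2n (le_trans norm_ge) // rmorph_sum.
by under [leRHS]eq_bigr => j _ do rewrite vE -rmorphXn.
Qed.

Lemma craig_min_length_ge : Num.sqrt (2 * m%:R) <= min_length (lattice_of B).
Proof.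
apply: lb_le_inf; last by move=> _ [v Lv <-]; exact: craig_lattice_norm_ge.
(* A lower bound passes to the infimum of a nonempty set: the first basis vector is a nonzero
   lattice vector because the rows are free. *)
have n_gt0 : (0 < n)%N by apply: leq_trans m_gt0 m_le_n.
pose z : 'rV[int]_n := delta_mx 0 (Ordinal n_gt0).
exists (enorm (map_mx intr z *m B)); exists (map_mx intr z *m B) => //.
split; first by exists z.
move=> /= /eqP; rewrite mulmx_free_eq0; last first.
  by apply: craig_basis_free; rewrite ?m_gt0 ?prime_gt0.
rewrite map_delta_mx => /eqP /matrixP /(_ 0 (Ordinal n_gt0)).
by rewrite !mxE !eqxx => /eqP; rewrite oner_eq0.
Qed.

Lemma lattice_volume_craig (l : nat) :
  lattice_volume (craig_basis R n m l) = l%:R ^+ (m - 1) * Num.sqrt n.+1%:R.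
Proof.
rewrite /lattice_volume det_gram_craig ?m_gt0 //.
by rewrite sqrtrM ?sqr_ge0 // sqrtr_sqr ger0_norm // exprn_ge0.
Qed.

Hypothesis p_le_2n : (p <= n.*2)%N.

(** Half the minimum is at least [sqrt (2m) / 2 = sqrt (m / 2)], and [p <= 2n] bounds the volume
    from above. *)
Lemma craig_center_density_ge :
  Num.sqrt (m%:R / 2) ^+ n / ((2 * n%:R) ^+ (m - 1) * Num.sqrt n.+1%:R) <=
  center_density B.
Proof.
rewrite /center_density lattice_volume_craig.
have sqrt2m : Num.sqrt (m%:R / 2) = Num.sqrt (2 * m%:R) / 2 :> R.
  have -> : m%:R / 2 = 2 * m%:R * (2^-1) ^+ 2 :> R by rewrite expr2; field.
  by rewrite [LHS]sqrtrM ?mulr_ge0 // sqrtr_sqr ger0_norm.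
have p_gt0 := prime_gt0 p_pr.
apply: ler_pM.
- by rewrite exprn_ge0 ?sqrtr_ge0.
- by rewrite invr_ge0 !mulr_ge0 ?exprn_ge0 ?mulr_ge0 ?sqrtr_ge0.
- rewrite sqrt2m lerXn2r ?nnegrE ?divr_ge0 ?sqrtr_ge0 //.
    by rewrite (le_trans (sqrtr_ge0 _) craig_min_length_ge).
  by rewrite ler_pM2r ?invr_gt0 // craig_min_length_ge.
- rewrite lef_pV2 ?posrE ?mulr_gt0 ?exprn_gt0 ?mulr_gt0 ?sqrtr_gt0 ?ltr0n //; last first.
    by apply: leq_trans m_gt0 m_le_n.
  rewrite ler_pM2r ?sqrtr_gt0 ?ltr0n // lerXn2r ?nnegrE ?mulr_ge0 //.
  by rewrite -natrM ler_nat mul2n.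
Qed.

End Craig.

(** * Real powers and the logarithm of the density *)

Lemma powR_half_nat (R : realType) (a : R) (n : nat) : 0 <= a ->
  a `^ (n%:R / 2) = Num.sqrt a ^+ n.
Proof. by move=> a0; rewrite mulrC powRrM powR12_sqrt // powR_mulrn ?sqrtr_ge0. Qed.

(** The factor [2^(n/2)] joins the numerator, and [2^(m-1)] joins the power of [n]. *)
Lemma craig_bound_powR (R : realType) (n m : nat) : (0 < m)%N ->
  m%:R `^ (n%:R / 2) /
    (2 `^ (m%:R - 1 + n%:R / 2) * n%:R ^+ (m - 1) * Num.sqrt (n.+1)%:R) =
  Num.sqrt (m%:R / 2) ^+ n / ((2 * n%:R) ^+ (m - 1) * Num.sqrt n.+1%:R) :> R.
Proof.
move=> m_gt0; rewrite powRD; last by rewrite pnatr_eq0 implybT.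
rewrite -(natrB R m_gt0) powR_mulrn // !powR_half_nat // sqrtrM // sqrtrV //.
rewrite exprMn exprVn exprMn [2 ^+ _ * _]mulrC -!mulrA; congr (_ * _).
by rewrite !invfM; ring.
Qed.

Lemma unit_ball_volume_ge (R : realType) (n : nat) :
  ball_const R n <= unit_ball_volume R n.
Proof.
rewrite -lee_fin /unit_ball_volume fineK; last first.
  rewrite ge0_fin_numE; last exact: lebesgue_volume_ge0.
  by rewrite (le_lt_trans (ball_volume_le n ler01)) // ltry.
by have := ball_volume_ge n (@ler01 R); rewrite expr1n mulr1.
Qed.

Lemma ball_const_sqr (R : realType) (n : nat) :
  ball_const R n ^+ 2 = (32 / 9) ^+ n / (n.+1)`!%:R.
Proof.
elim: n => [|n IHn]; first by rewrite /= expr1n expr0 (_ : 1`! = 1%N) // divr1.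
rewrite /= 2!exprMn IHn sqr_sqrtr ?divr_ge0 // [_ ^+ n.+1]exprS [n.+2`!]factS natrM.
have F_neq0 : (n.+1)`!%:R != 0 :> R by rewrite pnatr_eq0 -lt0n fact_gt0.
have n2_neq0 : n.+2%:R != 0 :> R by rewrite pnatr_eq0.
move: (n.+1)`!%:R n.+2%:R ((32 / 9) ^+ n) F_neq0 n2_neq0 => F N q F_neq0 N_neq0.
by field; rewrite F_neq0.
Qed.

Lemma ln_sqrt (R : realType) (x : R) : 0 <= x -> ln (Num.sqrt x) = 2^-1 * ln x.
Proof. by move=> x0; rewrite -powR12_sqrt // ln_powR. Qed.

(** A weak Stirling bound, [n! <= e n (n / e)^n]; the induction step is
    [(N + 1) ln ((N + 1) / N) >= 1]. *)
Lemma ln_fact_le (R : realType) (n : nat) : (0 < n)%N ->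
  ln (n`!%:R) <= 1 + ln n%:R + n%:R * ln n%:R - n%:R :> R.
Proof.
elim: n => // -[_ _|n /(_ isT) IHn _].
  by rewrite (_ : 1`! = 1%N) // ln1; lra.
rewrite factS natrM lnM ?posrE ?ltr0n ?fact_gt0 //.
set N : R := n.+1%:R in IHn *.
have N_gt0 : 0 < N by rewrite ltr0n.
have SN : n.+2%:R = N + 1 :> R by rewrite natr1.
rewrite SN; have step : 1 <= (N + 1) * (ln (N + 1) - ln N).
  have : ln (1 - (N + 1)^-1) <= - (N + 1)^-1.
    by apply: le_ln1Dx; rewrite ltrN2 invf_lt1 ?ltrDr // addr_gt0.
  have -> : 1 - (N + 1)^-1 = N / (N + 1) by field; rewrite gt_eqF // addr_gt0.
  rewrite ln_div ?posrE ?addr_gt0 // -opprB lerN2 -(ler_pM2l (addr_gt0 N_gt0 ltr01)).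
  by rewrite divff // gt_eqF // addr_gt0.
move: (ln (N + 1)) (ln N) (ln _) IHn step => a b c; nra.
Qed.

(** Logarithm of the center density bound times [ball_const R n]; the last summand is
    [ln (ball_const R n)]. *)
Definition log_density_bound (R : realType) (n m : nat) : R :=
  n%:R / 2 * (ln m%:R - ln 2) - (m%:R - 1) * (ln 2 + ln n%:R)
  - 2^-1 * ln n.+1%:R + 2^-1 * (n%:R * ln (32 / 9) - ln (n.+1)`!%:R).

Lemma ln_density_ge (R : realType) (n m p : nat) :
  prime p -> (n < p)%N -> (p <= n.*2)%N -> (0 < m)%N -> (m <= n)%N ->
  log_density_bound R n m <= ln (density (craig_basis R n m p)).
Proof.
move=> p_pr np pn m_gt0 mn.
have n_gt0 : (0 < n)%N by apply: leq_trans mn.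
have F_gt0 : 0 < (n.+1)`!%:R :> R by rewrite ltr0n fact_gt0.
have bc_gt0 : 0 < ball_const R n.
  rewrite lt_neqAle ball_const_ge0 andbT eq_sym -sqrf_eq0 ball_const_sqr.
  by rewrite gt_eqF // divr_gt0 // exprn_gt0 // divr_gt0.
have s_gt0 : 0 < Num.sqrt (m%:R / 2) :> R by rewrite sqrtr_gt0 divr_gt0 // ltr0n.
have s1_gt0 : 0 < Num.sqrt n.+1%:R :> R by rewrite sqrtr_gt0 ltr0n.
have n2_gt0 : 0 < 2 * n%:R :> R by rewrite mulr_gt0 // ltr0n.
have b_gt0 : 0 < Num.sqrt (m%:R / 2) ^+ n / ((2 * n%:R) ^+ (m - 1) * Num.sqrt n.+1%:R) :> R.
  by rewrite divr_gt0 ?mulr_gt0 ?exprn_gt0.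
have le := ler_pM (ltW b_gt0) (ltW bc_gt0)
  (craig_center_density_ge R p_pr np m_gt0 mn pn) (unit_ball_volume_ge R n).
have lhs_gt0 := mulr_gt0 b_gt0 bc_gt0.
apply: (@le_trans _ _ (ln (Num.sqrt (m%:R / 2) ^+ n /
    ((2 * n%:R) ^+ (m - 1) * Num.sqrt n.+1%:R) * ball_const R n))); last first.
  by rewrite ler_ln ?posrE //; exact: lt_le_trans le.
rewrite lnM ?posrE // ln_div ?posrE ?mulr_gt0 ?exprn_gt0 //.
rewrite [ln (_ * Num.sqrt _)]lnM ?posrE ?exprn_gt0 // !lnXn // !ln_sqrt ?divr_ge0 //.
rewrite ln_div ?posrE ?ltr0n // lnM ?posrE ?ltr0n //.
have -> : ln (ball_const R n) = 2^-1 * (n%:R * ln (32 / 9) - ln (n.+1)`!%:R).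
  rewrite -[ball_const R n]gtr0_norm // -sqrtr_sqr ln_sqrt ?sqr_ge0 // ball_const_sqr.
  by rewrite ln_div ?posrE ?exprn_gt0 ?divr_gt0 // lnXn ?divr_gt0 // -[ln _ *+ n]mulr_natl.
rewrite /log_density_bound -[_ *+ n]mulr_natl -[_ *+ (m - 1)]mulr_natl natrB //.
by lra.
Qed.

(* With [q = log2 n], the hypotheses say that [m] is [n / (2 q)] up to rounding.
   The constant left over, [ln (32 / 9) + 1 - 3 ln 2 = 1 - ln (9 / 4)] is positive. *)
Lemma log_density_bound_ge (R : realType) (n m : nat) (x q : R) :
    (0 < n)%N -> x = ln n%:R -> q = x / ln 2 -> 0 < x -> 2 * q < n%:R ->
    n%:R / (2 * q) - 1 <= m%:R -> m%:R - 1 <= n%:R / (2 * q) ->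
  n%:R * (- 2^-1 * ln q + (2^-1 * ln (1 - 2 * q / n%:R) - ln 2 ^+ 2 / 2 / x
      - ln n.+1%:R / n%:R - (1 + x) / 2 / n%:R)) <= log_density_bound R n m.
Proof.
move=> n_gt0 xE qE x_gt0 q_lt_n m_ge m_le.
have ln2_gt0 : 0 < ln 2 :> R by rewrite ln_gt0 // ltr1n.
have q_gt0 : 0 < q by rewrite qE divr_gt0.
set N : R := n%:R in q_lt_n m_ge m_le *.
have N_gt0 : 0 < N by rewrite ltr0n.
have u_gt0 : 0 < 1 - 2 * q / N by rewrite subr_gt0 ltr_pdivrMr // mul1r.
have ln_m : x - ln 2 - ln q + ln (1 - 2 * q / N) <= ln m%:R.
  have e : N / (2 * q) - 1 = N / (2 * q) * (1 - 2 * q / N).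
    by field; rewrite !gt_eqF.
  have Nq_gt0 : 0 < N / (2 * q) by rewrite divr_gt0 ?mulr_gt0.
  have pos : 0 < N / (2 * q) - 1 by rewrite e mulr_gt0.
  have m_gt0 : 0 < m%:R :> R by exact: lt_le_trans m_ge.
  apply: (@le_trans _ _ (ln (N / (2 * q) - 1))); last by rewrite ler_ln ?posrE.
  rewrite e lnM ?posrE // ln_div ?posrE ?mulr_gt0 //.
  by rewrite lnM ?posrE // -xE; lra.
(* Since [q = x / ln 2], the product [n / (2q) * ln (2n)] is linear in [n] up to a term of order
   [n / x]. *)
have hm : (m%:R - 1) * (ln 2 + x) <= N * (ln 2 ^+ 2 / 2 / x) + N * ln 2 / 2.
  have -> : N * (ln 2 ^+ 2 / 2 / x) + N * ln 2 / 2 = N / (2 * q) * (ln 2 + x).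
    by rewrite qE; field; rewrite !gt_eqF.
  by rewrite ler_wpM2r // addr_ge0 // ltW.
have const_ge0 : 0 <= ln (32 / 9) + 1 - 3 * ln 2 :> R.
  have -> : ln (32 / 9) = 5 * ln 2 - 2 * ln 3 :> R.
    have -> : 32 / 9 = 2 ^+ 5 / 3 ^+ 2 :> R by field.
    by rewrite ln_div ?posrE ?exprn_gt0 // !lnXn // !mulr_natl.
  (* The constant equals [1 - 2 ln (3 / 2)]. *)
  have : ln (3 / 2) <= 1 / 2 :> R.
    have -> : 3 / 2 = 1 + 1 / 2 :> R by field.
    by apply: le_ln1Dx; lra.
  by rewrite ln_div ?posrE //; lra.
(* Halved, the term [N * x] cancels the [N * x / 2] coming from [ln m]; this leaves [- N / 2 * ln q]
   as the main term. *)
have lf : ln (n.+1)`!%:R <= ln n.+1%:R + (1 + x + N * x - N).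
  rewrite factS natrM lnM ?posrE ?ltr0n ?fact_gt0 // lerD2l xE.
  exact: ln_fact_le.
rewrite /log_density_bound -xE -/N.
have hm2 := ler_wpM2l (ltW N_gt0) ln_m.
have hc := mulr_ge0 (ltW N_gt0) const_ge0.
have -> : N * (- 2^-1 * ln q + (2^-1 * ln (1 - 2 * q / N) - ln 2 ^+ 2 / 2 / x
      - ln n.+1%:R / N - (1 + x) / 2 / N)) =
  N * (- 2^-1 * ln q) + N * (2^-1 * ln (1 - 2 * q / N)) - N * (ln 2 ^+ 2 / 2 / x)
      - ln n.+1%:R - (1 + x) / 2.
  by field; rewrite !gt_eqF.
move: (N * (ln 2 ^+ 2 / 2 / x)) hm => t hm.
move: (ln (1 - _)) (ln q) (ln m%:R) (ln n.+1%:R) (ln _`!%:R) (ln (32 / 9)) (ln 2) hm hm2 hc lf.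
move=> a b c d e f g hm hm2 hc lf; lra.
Qed.

(** * Asymptotics *)

Section Limits.
Variable R : realType.

Lemma cvg_inv_nat : (n%:R : R)^-1 @[n --> \oo] --> 0.
Proof.
apply/gtr0_cvgV0; last exact: cvgr_idn.
by near=> n; rewrite ltr0n; near: n; exact: nbhs_infty_gt.
Unshelve. all: by end_near. Qed.

Lemma cvg_inv_ln_nat : (ln (n%:R : R))^-1 @[n --> \oo] --> 0.
Proof.
have lny : ln (n%:R : R) @[n --> \oo] --> +oo.
  apply/cvgryPge => A; near=> n.
  have n_ge : expR A <= n%:R by near: n; exact: (cvgryPge _).1 cvgr_idn _.
  by rewrite -ler_expR lnK // posrE (lt_le_trans (expR_gt0 A)).
apply/gtr0_cvgV0 => //.
near=> n; rewrite ln_gt0 // ltr1n; near: n; exact: nbhs_infty_gt.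
Unshelve. all: by end_near. Qed.

(** From [ln n = 2 ln (sqrt n) <= 2 sqrt n], the quotient is at most [2 / sqrt n]. *)
Lemma cvg_ln_nat_div : ln (n%:R : R) / n%:R @[n --> \oo] --> 0.
Proof.
apply: (@squeeze_cvgr _ _ _ _ (fun=> 0) (fun n => 2 * Num.sqrt (n%:R^-1))).
- near=> n; have n_gt0 : 0 < n%:R :> R by rewrite ltr0n; near: n; exact: nbhs_infty_gt.
  have s_gt0 : 0 < Num.sqrt n%:R :> R by rewrite sqrtr_gt0.
  rewrite divr_ge0 ?ln_ge0 ?ler1n -?(ltr0n R) ?(ltW n_gt0) //=.
  rewrite -{1 2}(sqr_sqrtr (ltW n_gt0)) lnXn // ler_pdivrMr ?exprn_gt0 //.
  rewrite sqrtrV ?(ltW n_gt0) //.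
  have -> : 2 * (Num.sqrt n%:R)^-1 * Num.sqrt n%:R ^+ 2 = Num.sqrt n%:R *+ 2 :> R.
    by rewrite -mulr_natl; field; rewrite gt_eqF.
  by rewrite ler_wMn2r // ltW // ln_sublinear.
- exact: cvg_cst.
- rewrite -[X in _ --> X](mulr0 2); apply: cvgM; first exact: cvg_cst.
  rewrite -[X in _ --> X](@sqrtr0 R).
  by apply: continuous_cvg; [exact: sqrt_continuous|exact: cvg_inv_nat].
Unshelve. all: by end_near. Qed.

Lemma cvg_ln_natS_div : ln (n.+1%:R : R) / n%:R @[n --> \oo] --> 0.
Proof.
apply: (@squeeze_cvgr _ _ _ _ (fun=> 0)
  (fun n => ln 2 * n%:R^-1 + ln (n%:R : R) / n%:R)).
- near=> n; have n_gt0 : (0 < n)%N by near: n; exact: nbhs_infty_gt.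
  rewrite divr_ge0 ?ln_ge0 ?ler1n //= -mulrDl ler_wpM2r ?invr_ge0 //.
  rewrite -lnM ?posrE ?ltr0n // ler_ln ?posrE ?mulr_gt0 ?ltr0n //.
  by rewrite -natrM ler_nat; lia.
- exact: cvg_cst.
- rewrite -[X in _ --> X]addr0; apply: cvgD; last exact: cvg_ln_nat_div.
  rewrite -[X in _ --> X](mulr0 (ln 2)).
  by apply: cvgM; [exact: cvg_cst|exact: cvg_inv_nat].
Unshelve. all: by end_near. Qed.

Lemma cvg_log2_nat_div : 2 * log2 (n%:R : R) / n%:R @[n --> \oo] --> 0.
Proof.
have -> : (fun n => 2 * log2 (n%:R : R) / n%:R) =
    (fun n => 2 / ln 2 * (ln (n%:R : R) / n%:R)).
  by apply/funext => n; rewrite /log2; ring.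
rewrite -[X in _ --> X](mulr0 (2 / ln 2)).
by apply: cvgM; [exact: cvg_cst|exact: cvg_ln_nat_div].
Qed.

(** The error term of [log_density_bound_ge] at [q = log2 n], still in natural logarithms. *)
Definition rate_error (n : nat) : R :=
  2^-1 * ln (1 - 2 * log2 n%:R / n%:R) - ln 2 ^+ 2 / 2 / ln n%:R
  - ln n.+1%:R / n%:R - (1 + ln n%:R) / 2 / n%:R.

Lemma cvg_rate_error : rate_error @ \oo --> 0.
Proof.
have -> : 0 = 2^-1 * ln (1 - 0) - ln 2 ^+ 2 / 2 * 0 - 0 - (2^-1 * 0 + 2^-1 * 0) :> R.
  by rewrite (subr0 1) ln1; ring.
have -> : rate_error = fun n => 2^-1 * ln (1 - 2 * log2 n%:R / n%:R)
  - ln 2 ^+ 2 / 2 * (ln n%:R)^-1 - ln n.+1%:R / n%:R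
  - (2^-1 * n%:R^-1 + 2^-1 * (ln n%:R / n%:R)).
  by apply/funext => n; rewrite /rate_error; ring.
apply: cvgB; [apply: cvgB; [apply: cvgB|]|apply: cvgD].
- apply: cvgM; first exact: cvg_cst.
  apply: (@continuous_cvg _ _ _ _ _ _ (@ln R)).
    by rewrite subr0; exact: continuous_ln.
  by apply: cvgB; [exact: cvg_cst|exact: cvg_log2_nat_div].
- by apply: cvgM; [exact: cvg_cst|exact: cvg_inv_ln_nat].
- exact: cvg_ln_natS_div.
- by apply: cvgM; [exact: cvg_cst|exact: cvg_inv_nat].
- by apply: cvgM; [exact: cvg_cst|exact: cvg_ln_nat_div].
Qed.

End Limits.

Theorem theorem2p2 (R : realType) :
  exists l : nat -> nat -> nat,
    (forall n m : nat, (0 < m)%N -> (2 * m < n)%N ->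
      [/\ (0 < l n m)%N,
          row_free (craig_basis R n m (l n m)) &
          center_density (craig_basis R n m (l n m)) >=
            m%:R `^ (n%:R / 2) /
            (2 `^ (m%:R - 1 + n%:R / 2) * n%:R ^+ (m - 1) *
             Num.sqrt (n.+1)%:R)]) /\
    exists m : nat -> nat,
      (forall n : nat, (2 < n)%N -> (0 < m n)%N /\ (2 * m n < n)%N) /\
      exists2 eps : nat -> R,
        eps @ \oo --> (0 : R) &
        forall n : nat, (2 < n)%N ->
          n%:R^-1 * log2 (density (craig_basis R n (m n) (l n (m n)))) >=
            - 2^-1 * log2 (log2 (n%:R : R)) + eps n.
Proof.
(* The prime depends on [n] alone; 0 is a default value at [n = 0]. *)
have /choice[l lP] n : exists p, (0 < n)%N -> [/\ prime p, (n < p)%N & (p <= n.*2)%N].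
  by case: n => [|n]; [exists 0%N|have [p] := bertrand (ltn0Sn n); exists p].
exists (fun n _ => l n); split=> [n m m_gt0 mn|].
  have n_gt0 : (0 < n)%N by lia.
  have m_le_n : (m <= n)%N by lia.
  have [p_pr np pn] := lP n n_gt0; split.
  - exact: prime_gt0.
  - by apply: craig_basis_free; rewrite ?m_gt0 ?prime_gt0.
  - by rewrite craig_bound_powR // craig_center_density_ge.
have ln2_gt0 : 0 < ln 2 :> R by rewrite ln_gt0 // ltr1n.
pose q n : R := log2 n%:R.
have q_gt1 n : (2 < n)%N -> 1 < q n.
  by move=> n_gt2; rewrite /q /log2 ltr_pdivlMr // mul1r ltr_ln ?posrE ?ltr0n ?ltr_nat //; lia.
pose t n : R := n%:R / (2 * q n).
(* The integer part of [n / (2 log2 n)], raised to 1 when it is 0; both [t - 1 <= m] and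
   [m - 1 <= t] survive. *)
pose m n := maxn 1 (Num.truncn (t n)).
have t_ge0 n : (2 < n)%N -> 0 <= t n.
  by move=> /q_gt1 q1; rewrite divr_ge0 // mulr_ge0 // ltW // (lt_trans ltr01).
have m_bounds n : (2 < n)%N -> (0 < m n)%N /\ (2 * m n < n)%N.
  move=> n_gt2; split; first by rewrite leq_max.
  rewrite /m; case: (leqP 1 (Num.truncn (t n))) => [t1|_]; last by rewrite muln1.
  have := truncn_le (t n); rewrite t_ge0 // => t_le.
  rewrite -(ltr_nat R) natrM.
  apply: (@le_lt_trans _ _ (2 * t n)); first by rewrite ler_wpM2l.
  rewrite /t; have q1 := q_gt1 n n_gt2; have q0 := lt_trans ltr01 q1.
  have -> : 2 * (n%:R / (2 * q n)) = n%:R / q n by field; rewrite gt_eqF.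
  by rewrite ltr_pdivrMr // ltr_pMr // ltr0n; lia.
exists m; split => //.
pose rate n : R := n%:R^-1 * log2 (density (craig_basis R n (m n) (l n))).
(* The minimum of 0 and the actual slack makes the inequality hold for every [n > 2]. Convergence to
   0 then follows from an eventual lower bound on the slack. *)
exists (fun n => Num.min 0 (rate n + 2^-1 * log2 (q n))); last first.
  by move=> n n_gt2; rewrite -lerBrDl mulNr opprK -/(rate n) ge_min lexx orbT.
apply: (@squeeze_cvgr _ _ _ _ (fun n => - `|rate_error R n / ln 2|) (fun=> 0)).
- near=> n; rewrite ge_min lexx /= andbT le_min oppr_le0 normr_ge0 /=.
  apply: le_trans (_ : rate_error R n / ln 2 <= _).
    by rewrite lerNl -normrN ler_norm.
  have n_gt2 : (2 < n)%N by near: n; exact: nbhs_infty_gt.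
  have n_gt0 : (0 < n)%N by lia.
  have N_gt0 : 0 < n%:R :> R by rewrite ltr0n.
  (* Eventually [2 log2 n < n], which keeps the argument of the logarithm in [rate_error]
     positive. *)
  have u_lt1 : 2 * q n / n%:R < 1.
    by near: n; exact: (cvgr_lt _ (@cvg_log2_nat_div R)).
  have [m_gt0 mn] := m_bounds n n_gt2.
  have [p_pr np pn] := lP n n_gt0.
  have m_le_n : (m n <= n)%N by lia.
  have t_ge := t_ge0 n n_gt2.
  have /andP[trunc_le trunc_gt] := truncn_itv t_ge.
  have m_ge : t n - 1 <= (m n)%:R.
    rewrite lerBlDr natr1 (le_trans (ltW trunc_gt)) // ler_nat ltnS.
    exact: leq_maxr.
  have m_le : (m n)%:R - 1 <= t n.
    rewrite lerBlDr /m; case: leqP => _; last by rewrite lerDr.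
    by rewrite (le_trans trunc_le) // lerDl.
  have x_gt0 : 0 < ln (n%:R : R) by rewrite ln_gt0 // ltr1n ltnW.
  have qn : 2 * q n < n%:R by rewrite -[ltRHS]mul1r -ltr_pdivrMr.
  have := log_density_bound_ge n_gt0 (erefl _) (erefl _) x_gt0 qn m_ge m_le.
  move=> /le_trans /(_ (ln_density_ge R p_pr np pn m_gt0 m_le_n)).
  rewrite -/(rate_error R n) => main.
  move: main; rewrite /rate -[log2 (q n)]/(ln (q n) / ln 2).
  rewrite -[log2 (density _)]/(ln (density _) / ln 2).
  move: (ln (density _)) (ln (q n)) (rate_error R n) => d lq err main.
  have -> : n%:R^-1 * (d / ln 2) + 2^-1 * (lq / ln 2) = (n%:R^-1 * d + 2^-1 * lq) / ln 2.
    by ring.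
  rewrite ler_pM2r ?invr_gt0 // -lerBlDr -(ler_pM2l N_gt0) mulVKf ?gt_eqF //.
  by rewrite [err - _]addrC -mulNr.
- rewrite -oppr0; apply: cvgN; rewrite -[X in _ --> X](@normr0 _ R).
  apply: cvg_norm; rewrite -[X in _ --> X](mul0r (ln 2)^-1).
  by apply: cvgM; [exact: cvg_rate_error|exact: cvg_cst].
- exact: cvg_cst.
Unshelve. all: by end_near. Qed.
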